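(* Let $\epsilon > 0$. For every sufficiently large prime $p$ there is a nonempty subset $S \subseteq \mathbf{Z}/p$ with $$\mathsf{R}\bigl(\mathbf{C}[\mathbf{Z}/p], U_S\bigr) \geq (1 - \epsilon) \ln p.$$ Consequently, $\mathsf{C}(\mathbf{C}[\mathbf{Z}/p]) = (1 + o(1)) \ln \dim \mathbf{C}[\mathbf{Z}/p]$ as $p \to \infty$ through primes. Here the acting group is the Heisenberg group $H_p$ in its Schrödinger representation.
   Context: For an odd prime $p$ let $\omega = e^{2\pi i/p}$ and let $V = \mathbf{C}[\mathbf{Z}/p]$ have basis $(e_j)_{j \in \mathbf{Z}/p}$. Define operators $X e_j = e_{j+1}$ and $Z e_j = \omega^j e_j$. The Heisenberg group is $H_p = \langle X, Z\rangle \leq \mathrm{GL}(V)$ (of order $p^3$), and its action on $V$ is the (irreducible) Schrödinger representation. For a nonempty subset $S \subseteq \mathbf{Z}/p$, $U_S = \langle e_s \mid s \in S\rangle$ is the coordinate subspace on $S$. For a group $H$ acting linearly on a finite-dimensional complex vector space $V$ and a nonzero subspace $U \leq V$, the group-additive diameter is $$\mathrm{diam}_+^{H}(V,U) = \min\{ m \mid g_1\cdot U + \dots + g_m\cdot U = V \text{ for some } g_1,\dots,g_m \in H\}.$$ If $H$ acts irreducibly on $V$, put $\mathsf{R}(V,U) = \mathrm{diam}_+^{H}(V,U) / \lceil \dim V/\dim U\rceil$, and the covering complexity of $V$ (with respect to $H$) is $\mathsf{C}(V) = \max_{0 \neq U \leq V} \mathsf{R}(V,U)$. In the claim $H = H_p$.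 *)

(* Defs.v *)
From HB Require Import structures.
From mathcomp Require Import all_boot all_order all_algebra.
From mathcomp Require Import complex.
From mathcomp Require Import all_classical all_reals all_analysis.

Set Implicit Arguments.
Unset Strict Implicit.
Unset Printing Implicit Defensive.

Import Order.TTheory GRing.Theory Num.Theory.
Import numFieldNormedType.Exports.

Local Open Scope classical_set_scope.
Local Open Scope ring_scope.

Section CoveringComplexity.

Variables (R : realType) (V : vectType R[i]).

(* Subgroups of GL(V); an invertible endomorphism is one with zero kernel, and
   [f^-1] is its inverse. *)
Definition linear_group (H : set 'End(V)) : Prop :=
  [/\ forall g, H g -> lker g = 0%VS,
      H \1%VF,
      forall g h, H g -> H h -> H (g \o h)%VF &
      forall g, H g -> H (g^-1)%VF].

Definition generated_group (A : set 'End(V)) : set 'End(V) :=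
  smallest linear_group A.

Definition irreducible_action (H : set 'End(V)) : Prop :=
  {:V}%VS <> 0%VS /\
  forall U : {vspace V}, (forall g, H g -> (g @: U <= U)%VS) ->
    U = 0%VS \/ U = {:V}%VS.

Definition covers (H : set 'End(V)) (U : {vspace V}) (m : nat) : Prop :=
  exists g : 'I_m -> 'End(V),
    (forall i, H (g i)) /\ (\sum_(i < m) (g i @: U))%VS = {:V}%VS.

Lemma covers_exists (H : set 'End(V)) (U : {vspace V}) :
  linear_group H -> irreducible_action H -> U <> 0%VS ->
  exists m, `[< covers H U m >].
Proof.
move=> [_ H1 HM _] [_ irrH] U0.
pose S m (g : 'I_m -> 'End(V)) := (\sum_(i < m) (g i @: U))%VS.
pose P n := `[< exists m (g : 'I_m -> 'End(V)),
  [/\ forall i, H (g i), (U <= S m g)%VS & \dim (S m g) = n] >].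
have exP : exists n, P n.
  exists (\dim U); apply/asboolP; exists 1%N, (fun _ => \1%VF); split=> //.
  - by rewrite /S big_ord1 lim1g.
  - by rewrite /S big_ord1 lim1g.
have ubP n : P n -> (n <= \dim {:V})%N.
  by move=> /asboolP[m [g [_ _ <-]]]; exact: dimvS (subvf _).
case: (ex_maxnP exP ubP) => n /asboolP[m [g [Hg US dimS]]] maxn.
have absorb h : H h -> (h @: U <= S m g)%VS.
  move=> Hh.
  pose g' (i : 'I_m.+1) := if unlift ord0 i is Some j then g j else h.
  have Sg' : S m.+1 g' = (h @: U + S m g)%VS.
    rewrite /S big_ord_recl /g' unlift_none; congr (_ + _)%VS.
    by apply: eq_bigr => i _; rewrite liftK.
  have sub : (S m g <= S m.+1 g')%VS by rewrite Sg' addvSr.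
  have : P (\dim (S m.+1 g')).
    apply/asboolP; exists m.+1, g'; split=> //.
    - by move=> i; rewrite /g'; case: unliftP => [j _|_].
    - exact: subv_trans US sub.
  move=> /maxn; rewrite -dimS => le.
  have /eqP -> : S m g == S m.+1 g'.
    by rewrite eqEdim sub le.
  by rewrite Sg' addvSl.
exists m; apply/asboolP; exists g; split=> //.
case: (irrH (S m g)) => //.
  move=> h Hh; rewrite /S limg_sum; apply/subv_sumP => i _.
  by rewrite -limg_comp; apply: absorb; exact: HM.
by move=> S0; case: U0; apply/eqP; rewrite -subv0 -S0.
Qed.

(* The default value [0%N] is never used when [H] is an irreducible linear group
   and [U] is nonzero, by [covers_exists]. *)
Definition diam_plus (H : set 'End(V)) (U : {vspace V}) : nat :=
  if pselect (exists m, `[< covers H U m >]) is left ex then ex_minn ex else 0%N.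

Definition relative_diam (H : set 'End(V)) (U : {vspace V}) : R :=
  (diam_plus H U)%:R /
  (Num.ceil ((\dim {:V})%:R / (\dim U)%:R : R))%:~R.

(* The maximum of a set of reals ([0] if there is none).  In the application below
   the set is finite and nonempty. *)
Definition set_max (A : set R) : R := xget 0 (A `&` ubound A).

Definition covering_complexity (H : set 'End(V)) : R :=
  set_max [set relative_diam H U | U in [set U : {vspace V} | U <> 0%VS]].

End CoveringComplexity.

Section Schroedinger.

Variables (R : realType) (p : nat).

(* [R[i]^o] is [R[i]] as a vector space over itself; 'F_p is the ring Z/p when
   [p] is prime. *)
Definition group_algebra : vectType R[i] := {ffun 'F_p -> R[i]^o}.

Definition basis_vec (j : 'F_p) : group_algebra :=
  [ffun k => (k == j)%:R : R[i]^o].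

Definition linear_extension (f : 'F_p -> group_algebra) : 'End(group_algebra) :=
  linfun (fun v : group_algebra =>
    \sum_(j : 'F_p) ((v : {ffun 'F_p -> R[i]^o}) j : R[i]) *: f j).

Definition omega : R[i] :=
  Complex (cos (2 * pi / p%:R)) (sin (2 * pi / p%:R)).

Definition heisX : 'End(group_algebra) :=
  linear_extension (fun j => basis_vec (j + 1)).

Definition heisZ : 'End(group_algebra) :=
  linear_extension (fun j => omega ^+ (j : nat) *: basis_vec j).

Definition heisenberg : set 'End(group_algebra) :=
  generated_group [set heisX; heisZ].

Definition coord_subspace (S : {set 'F_p}) : {vspace group_algebra} :=
  (\sum_(s in S) <[basis_vec s]>)%VS.

Lemma linear_extension_basis f j : linear_extension f (basis_vec j) = f j.
Proof.
pose F (v : group_algebra) : group_algebra :=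
  \sum_(j : 'F_p) ((v : {ffun 'F_p -> R[i]^o}) j : R[i]) *: f j.
have linF : linear F.
  move=> a u v; rewrite /F scaler_sumr -big_split /=; apply: eq_bigr => k _.
  by rewrite !ffunE scalerDl scalerA.
pose HF := GRing.isLinear.Build _ _ _ _ F linF.
pose FL : {linear group_algebra -> group_algebra} := HB.pack F HF.
rewrite /linear_extension -[X in linfun X]/(FL : _ -> _) lfunE /= /F.
rewrite (bigD1 j) //= big1 ?addr0 => [|k kj]; first by rewrite ffunE eqxx scale1r.
by rewrite ffunE (negbTE kj) scale0r.
Qed.

Lemma heisX_basis j : heisX (basis_vec j) = basis_vec (j + 1).
Proof. exact: linear_extension_basis. Qed.

Lemma heisZ_basis j : heisZ (basis_vec j) = omega ^+ (j : nat) *: basis_vec j.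
Proof. exact: linear_extension_basis. Qed.

Lemma group_algebra_sum (v : group_algebra) :
  v = \sum_(j : 'F_p) ((v : {ffun 'F_p -> R[i]^o}) j : R[i]) *: basis_vec j.
Proof.
apply/ffunP => k; rewrite sum_ffunE (bigD1 k) //= big1 => [|j jk].
  by rewrite !ffunE eqxx addr0 [RHS]mulr1.
by rewrite !ffunE eq_sym (negbTE jk) [LHS]mulr0.
Qed.

Lemma linear_extension_lker0 f g :
  (forall j, linear_extension g (f j) = basis_vec j) ->
  lker (linear_extension f) = 0%VS.
Proof.
move=> gf; apply/eqP/lker0P.
apply: (can_inj (g := linear_extension g)) => v.
rewrite [in LHS](group_algebra_sum v) [in RHS](group_algebra_sum v).
rewrite !linear_sum; apply: eq_bigr => j _.
by rewrite !linearZ /= linear_extension_basis gf.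
Qed.

Lemma omega_neq0 : omega != 0.
Proof.
apply/eqP => -[c0 s0]; have := cos2Dsin2 (2 * pi / p%:R : R).
by rewrite c0 s0 expr0n addr0 => /eqP; rewrite eq_sym oner_eq0.
Qed.

Lemma heisenberg_linear_group : linear_group heisenberg.
Proof.
pose GL : set 'End(group_algebra) := [set g | lker g = 0%VS].
have GLgroup : linear_group GL.
  split=> //.
  - by apply/eqP/lker0P => u v; rewrite !id_lfunE.
  - move=> g h /eqP/lker0P Hg /eqP/lker0P Hh; apply/eqP/lker0P => u v.
    by rewrite !comp_lfunE => /Hg/Hh.
  - move=> g /eqP Hg; apply/eqP/lker0P.
    by apply: (can_inj (g := g)) => v; rewrite lker0_lfunVK.
have GLXZ : [set heisX; heisZ] `<=` GL.
  move=> _ [->|->].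
  - apply: (@linear_extension_lker0 _ (fun j => basis_vec (j - 1))) => j.
    by rewrite linear_extension_basis addrK.
  - apply: (@linear_extension_lker0 _
      (fun j => (omega ^+ (j : nat))^-1 *: basis_vec j)) => j.
    rewrite linearZ /= linear_extension_basis scalerA divff ?scale1r //.
    by rewrite expf_neq0 // omega_neq0.
split.
- by move=> g Hg; apply: (Hg GL); split.
- by move=> M [[]].
- by move=> g h Hg Hh M HM; have [[_ _ mM _] _] := HM; apply: mM; [exact: Hg|exact: Hh].
- by move=> g Hg M HM; have [[_ _ _ vM] _] := HM; apply: vM; exact: Hg.
Qed.

End Schroedinger.

Arguments heisenberg R p : clear implicits.

(* Main.v *)
From HB Require Import structures.
Require Import Defs.
From mathcomp Require Import all_boot all_order all_algebra.
From mathcomp Require Import complex ring lra zify.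
From mathcomp Require Import all_classical all_reals all_analysis.

(** Both halves compare [ln p] with the number of translates of a subspace of
    dimension [u] needed to fill a space of dimension [p].

    Lower bound.  Up to scalars the Heisenberg group permutes the coordinate
    lines by translations, so the diameter of [U_S] is the number of translates
    of [S] needed to cover Z/p.  Let [S] be random of constant density
    [1 / n.+1], as the zero set of a uniform labelling with [n.+1] labels.  A
    fixed set of [m = (1 - eps) n ln p] translates leaves each point uncovered
    with probability about [p ^ (eps - 1)].  A maximal-family argument
    ([disjoint_translates]) yields about [p / m ^ 2] points for which these
    events are independent, so the translates cover everything with probability
    at most [exp (- p ^ eps / m ^ 2)], much smaller than the inverse [p ^ - m]
    of the number of choices of translates.  Hence some [S] of density at least
    [1 / n.+2] is covered by no [m] translates ([thick_set_hard_to_cover],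
    [near_union_bound]), and [n] may be taken large depending on [eps].

    Upper bound.  The [p ^ 2] operators [Z^b X^a] are unitary and conjugating a
    matrix by them averages it to a scalar matrix ([weyl_mx_schur]).  The
    dimension of an intersection of two subspaces is at most the trace of the
    product of their orthogonal projectors ([rank_cap_le_trace]); averaging this
    trace shows that for all [W] and [U] some [g] in the group satisfies
    [p * dim (W :&: g U) <= dim W * dim U].  Adding this [g U] to [W] multiplies
    the codimension by at most [1 - u / p], so [(p / u) * ln p + 1] translates
    fill the space ([heisenberg_diam]) and every relative diameter is at most
    [ln p + 1] ([relative_diam_le]).  Together with the lower bound this gives
    the asymptotics of the covering complexity, a maximum attained because
    relative diameters take finitely many values. *)

Set Implicit Arguments.
Unset Strict Implicit.
Unset Printing Implicit Defensive.
Import Order.TTheory GRing.Theory Num.Theory.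
Import numFieldNormedType.Exports.
Local Open Scope ring_scope.

(** * Random sets that few translates cannot cover *)

Section Labellings.
Import mathcomp.boot.fintype mathcomp.boot.finset.
Variables (R : realFieldType) (G : finType) (n : nat).
(* The probability that a uniform label in ['I_n.+1] is nonzero. *)
Let q : R := 1 - n.+1%:R^-1.

Lemma q_nat : n.+1%:R * q = n%:R.
Proof. by rewrite /q mulrBr mulr1 divff ?pnatr_eq0 // -natr1 addrK. Qed.

Lemma sum_avoid (D : {set G}) :
  \sum_(f : {ffun G -> 'I_n.+1}) \prod_(t in D) (f t != ord0)%:R
    = n.+1%:R ^+ #|G| * q ^+ #|D|.
Proof.
under eq_bigr => f _ do rewrite big_mkcond /=.
pose F (t : G) (y : 'I_n.+1) : R := if t \in D then (y != ord0)%:R else 1.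
rewrite -(bigA_distr_bigA F) /=.
have sumF t : \sum_y F t y = n.+1%:R * (if t \in D then q else 1).
  rewrite /F; case: ifP => _.
    rewrite q_nat big_ord_recl eqxx add0r.
    by under eq_bigr do rewrite /=; rewrite sumr_const card_ord.
  by rewrite sumr_const card_ord mulr1.
by rewrite (eq_bigr _ (fun t _ => sumF t)) big_split /= -big_mkcond /=
   !prodr_const.
Qed.

(** Independence over disjoint blocks, in counting form: the factors
    [1 - \prod_(t in B i) (f t != ord0)] and [\prod_(t in D) (f t != ord0)]
    are the indicators of a zero of [f] in the block [B i] and of no zero in
    [D].  The set [D] makes the induction on the list of blocks go through:
    expanding the first factor moves its block into [D]. *)
Lemma sum_hit_avoid (I : eqType) (B : I -> {set G}) b (X : seq I) (D : {set G}) :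
  uniq X -> {in X, forall i, #|B i| = b} ->
  {in X, forall i, [disjoint B i & D]} ->
  {in X &, forall i j, i != j -> [disjoint B i & B j]} ->
  \sum_(f : {ffun G -> 'I_n.+1})
     (\prod_(i <- X) (1 - \prod_(t in B i) (f t != ord0)%:R)) *
       \prod_(t in D) (f t != ord0)%:R
    = n.+1%:R ^+ #|G| * (1 - q ^+ b) ^+ size X * q ^+ #|D|.
Proof.
elim: X D => [|i X IH] D /=.
  move=> *; under eq_bigr do rewrite big_nil mul1r.
  by rewrite sum_avoid expr0 mulr1.
move=> /andP[iX uX] cB dD dB.
have sub j : j \in X -> j \in i :: X by rewrite inE orbC => ->.
have dDi : [disjoint B i & D] by apply: dD; rewrite inE eqxx.
pose Q f (A : {set G}) : R := \prod_(t in A) ((f : {ffun G -> 'I_n.+1}) t != ord0)%:R.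
pose P f : R := \prod_(j <- X) (1 - Q f (B j)).
transitivity (\sum_f (P f * Q f D - P f * Q f (D :|: B i))).
  apply: eq_bigr => f _; rewrite big_cons.
  rewrite -[X in (1 - X) * _]/(Q f (B i)) -[X in _ * X * _]/(P f).
  rewrite -[X in _ * X = _]/(Q f D).
  suff -> : Q f (D :|: B i) = Q f D * Q f (B i) by ring.
  rewrite /Q (eq_bigl [predU D & B i]) => [|t]; last by rewrite !inE.
  by rewrite bigU //= disjoint_sym.
rewrite sumrB !IH //; first last.
- by move=> j k /sub jX /sub kX; exact: dB.
- by move=> j /sub; exact: dD.
- by move=> j /sub; exact: cB.
- by move=> j k /sub jX /sub kX; exact: dB.
- move=> j jX; have /dD := sub _ jX; rewrite -!setI_eq0 setIUr => /eqP ->.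
  rewrite set0U setI_eq0; apply: dB; [exact: sub|by rewrite inE eqxx|].
  by apply: contraNneq iX => <-.
- by move=> j /sub; exact: cB.
have -> : #|D :|: B i| = (#|D| + b)%N.
  by rewrite cardsU disjoint_setI0 1?disjoint_sym // cards0 subn0 cB // inE eqxx.
by rewrite exprD exprS; ring.
Qed.

(** The zero set of a uniform [f] has mean size [#|G| / n.+1], and its size is
    at most [#|G|]; so it reaches the smaller value [#|G| / n.+2] with
    probability at least [1 / n.+1 - 1 / n.+2].  This crude bound suffices
    because it is compared with an event of superpolynomially small
    probability. *)
Lemma many_large_zero_sets :
  n.+1%:R ^+ #|G| <= (n.+1 * n.+2)%:R *
    \sum_(f : {ffun G -> 'I_n.+1})
      (#|G| <= n.+2 * #|[set t | f t == ord0]|)%:R :> R.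
Proof.
have [G0|Gpos] := posnP #|G|.
  rewrite G0 expr0.
  rewrite (eq_bigr (fun=> 1)) => [|f _]; last by rewrite leq0n.
  rewrite sumr_const -natrM -[1]/(1%:R) ler_nat.
  by rewrite !muln_gt0 card_ffun G0.
have mean : \sum_(f : {ffun G -> 'I_n.+1}) #|[set t | f t == ord0]|%:R
    = #|G|%:R * n.+1%:R ^+ #|G| / n.+1%:R :> R.
  under eq_bigr => f _ do rewrite -sum1dep_card natr_sum big_mkcond /=.
  rewrite exchange_big /= (eq_bigr (fun=> n.+1%:R ^+ #|G| / n.+1%:R)).
    by rewrite sumr_const -mulrA [RHS]mulr_natl.
  move=> t _.
  have sumt : \sum_(f : {ffun G -> 'I_n.+1}) (f t != ord0)%:R
      = n.+1%:R ^+ #|G| - n.+1%:R ^+ #|G| / n.+1%:R :> R.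
    have := sum_avoid [set t]; rewrite cards1 expr1 /q mulrBr mulr1 => <-.
    by apply: eq_bigr => f _; rewrite (big_pred1 t) // => s; rewrite inE.
  transitivity (\sum_(f : {ffun G -> 'I_n.+1}) (1 - (f t != ord0)%:R) : R).
    by apply: eq_bigr => f _; case: eqP => _; rewrite ?subr0 ?subrr.
  rewrite sumrB sumt sumr_const card_ffun card_ord natrX; ring.
have bound : \sum_(f : {ffun G -> 'I_n.+1}) #|[set t | f t == ord0]|%:R <=
    #|G|%:R * (\sum_(f : {ffun G -> 'I_n.+1})
      (#|G| <= n.+2 * #|[set t | f t == ord0]|)%:R)
    + #|G|%:R * n.+1%:R ^+ #|G| / n.+2%:R :> R.
  apply: (@le_trans _ _ (\sum_(f : {ffun G -> 'I_n.+1})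
    (#|G|%:R * (#|G| <= n.+2 * #|[set t | f t == ord0]|)%:R + #|G|%:R / n.+2%:R))).
    apply: ler_sum => f _; case: leqP => h.
      by rewrite mulr1 ler_wpDr ?divr_ge0 ?ler0n ?ler_nat ?max_card.
    rewrite mulr0 add0r ler_pdivlMr ?ltr0n // -natrM ler_nat mulnC.
    exact: ltnW.
  rewrite big_split /= -mulr_sumr sumr_const card_ffun card_ord lerD2l.
  by rewrite -[X in X <= _]mulr_natr natrX mulrAC.
have arith (a b g M S : R) : 0 < g -> 0 < a -> b = a + 1 ->
    g * M / a <= g * S + g * M / b -> M <= a * b * S.
  move=> g0 a0 ba; have b0 : 0 < b by rewrite ba ltr_wpDr.
  rewrite -!(mulrA g) -mulrDr ler_pM2l // => h.
  have : (M / a) * (a * b) <= (S + M / b) * (a * b) by rewrite ler_pM2r ?mulr_gt0.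
  have -> : M / a * (a * b) = M * b by field; rewrite gt_eqF.
  have -> : (S + M / b) * (a * b) = a * b * S + M * a by field; rewrite gt_eqF.
  by rewrite ba; lra.
move: bound; rewrite mean natrM; apply: arith; rewrite ?ltr0n //.
by rewrite natr1.
Qed.

End Labellings.

Section Translates.
Import mathcomp.boot.fintype mathcomp.boot.finset.
Variable G : finZmodType.

(** Two reflected translates [x - T] and [y - T] meet only if [y] lies in
    [x + (T - T)].  So for a maximal family of centres with disjoint translates,
    the sets [x + (T - T)], of size at most [#|T| ^ 2], cover the group. *)
Lemma disjoint_translates (T : {set G}) : T != set0 ->
  exists X : {set G},
    {in X &, forall x y, x != y ->
       [disjoint [set x - t | t in T] & [set y - t | t in T]]} /\
    (#|G| <= #|X| * #|T| ^ 2)%N.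
Proof.
move=> T0.
pose P (X : {set G}) := [forall x in X, forall y in X, (x != y) ==>
  [disjoint [set x - t | t in T] & [set y - t | t in T]]].
have [|X /maxsetP[PX maxX]] := @ex_maxset _ P.
  by exists set0; apply/forall_inP => x; rewrite inE.
have disX : {in X &, forall x y, x != y ->
       [disjoint [set x - t | t in T] & [set y - t | t in T]]}.
  by move=> x y xX yX xy; move/forall_inP/(_ x xX)/forall_inP/(_ y yX)/implyP/(_ xy): PX.
exists X; split => //.
suff cov : [set: G] \subset [set u.1 + (u.2.1 - u.2.2) | u in setX X (setX T T)].
  rewrite -cardsT (leq_trans (subset_leq_card cov)) //.
  by rewrite (leq_trans (leq_imset_card _ _)) // !cardsX mulnn.
apply/subsetP => z _; apply/imsetP.
have [/existsP[x /andP[xX]]|] := boolP [exists x in X,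
    ~~ [disjoint [set x - t | t in T] & [set z - t | t in T]]].
  rewrite -setI_eq0 => /set0Pn[w]; rewrite inE => /andP[/imsetP[t tT ->]].
  move=> /imsetP[s sT e]; exists (x, (s, t)); first by rewrite !inE xX sT tT.
  by rewrite /= addrCA e addrC subrK.
rewrite negb_exists => /forallP nX.
have {}nX x : x \in X -> [disjoint [set x - t | t in T] & [set z - t | t in T]].
  by move=> xX; have := nX x; rewrite xX /= negbK.
have zX : z \in X.
  rewrite -(maxX (z |: X)) ?subsetUr ?setU11 //.
  apply/forall_inP => x /setU1P xX; apply/forall_inP => y /setU1P yX.
  apply/implyP => xy; case: xX xy => [->|xX]; case: yX => [->|yX] xy.
  - by rewrite eqxx in xy.
  - by rewrite disjoint_sym nX.
  - exact: nX.
  - exact: disX.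
case/set0Pn: T0 => t tT; exists (z, (t, t)); first by rewrite !inE zX tT.
by rewrite /= subrr addr0.
Qed.

(** Take for [S] the zero set of a uniform labelling with labels in ['I_n.+1].
    The translates of [S] by the values [T] of [t] cover [G] exactly when [S]
    meets every [z - T]; on [r] disjoint sets of this form these events are
    independent, so all of them hold with probability at most
    [(1 - q ^+ m) ^+ r].  The hypothesis says that the union bound over the
    [#|G| ^ m] choices of [t] stays below the probability that [S] is large. *)
Lemma thick_set_hard_to_cover (R : realFieldType) (n m : nat) :
  (0 < m)%N ->
  let q : R := 1 - n.+1%:R^-1 in
  (forall r : nat, (#|G| <= r * m ^ 2)%N ->
     (n.+1 * n.+2)%:R * #|G|%:R ^+ m * (1 - q ^+ m) ^+ r < 1) ->
  exists S : {set G}, (#|G| <= n.+2 * #|S|)%N /\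
    forall t : 'I_m -> G, exists z, forall i, z - t i \notin S.
Proof.
move=> m0 q small.
pose N := n.+1; pose Z (f : {ffun G -> 'I_N}) := [set x | f x == ord0].
pose hit (f : {ffun G -> 'I_N}) (t : {ffun 'I_m -> G}) :=
  [forall z, exists i, z - t i \in Z f].
pose M : R := N%:R ^+ #|G|.
have M0 : 0 < M by rewrite exprn_gt0 // ltr0n.
have q1 : 0 <= q <= 1.
  by rewrite /q subr_ge0 invf_le1 ?ltr0n // ler1n /= gerBl invr_ge0 ler0n.
have cov t : (N * n.+2)%:R * #|G|%:R ^+ m * \sum_f (hit f t)%:R < M :> R.
  pose T := [set t i | i : 'I_m].
  have T0 : T != set0.
    by apply/set0Pn; exists (t (Ordinal m0)); apply: imset_f.
  have [X [disX cX]] := disjoint_translates T0.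
  have cT : (#|T| <= m)%N by rewrite -[X in (_ <= X)%N]card_ord leq_imset_card.
  pose B x := [set x - t | t in T].
  have cB x : #|B x| = #|T| by rewrite card_imset // => u v /addrI/oppr_inj.
  have h1 : {in enum X, forall x, #|B x| = #|T|} by move=> x _; exact: cB.
  have h2 : {in enum X, forall x, [disjoint B x & (set0 : {set G})]}.
    by move=> x _; rewrite -setI_eq0 setI0.
  have h3 : {in enum X &, forall x y, x != y -> [disjoint B x & B y]}.
    by move=> x y; rewrite !mem_enum; exact: disX.
  have := sum_hit_avoid R n (enum_uniq _) h1 h2 h3.
  rewrite cards0 expr0 mulr1 -/q -/N -/M -cardE => sumB.
  have le : \sum_f (hit f t)%:R <= M * (1 - q ^+ m) ^+ #|X| :> R.
    apply: (@le_trans _ _ (M * (1 - q ^+ #|T|) ^+ #|X|)); last first.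
      rewrite ler_pM2l // lerXn2r ?nnegrE ?subr_ge0 ?exprn_ile1 //; try by case/andP: q1.
      by rewrite lerB // ler_wiXn2l //; case/andP: q1.
    rewrite -sumB; apply: ler_sum => f _; rewrite big_set0 mulr1.
    rewrite big_enum /=.
    have [hf|_] := boolP (hit f t); last first.
      apply: prodr_ge0 => x _; rewrite subr_ge0.
      by rewrite prodr_ile1 // => s _; rewrite ler0n lern1 leq_b1.
    rewrite big1 // => x _.
    case: (existsP (forallP hf x)) => i; rewrite inE => /eqP fi.
    rewrite (bigD1 (x - t i)) /=; last by apply/imset_f/imset_f.
    by rewrite fi eqxx mul0r subr0.
  apply: (@le_lt_trans _ _ ((N * n.+2)%:R * #|G|%:R ^+ m * (M * (1 - q ^+ m) ^+ #|X|))).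
    by rewrite ler_wpM2l // mulr_ge0 ?exprn_ge0 ?ler0n.
  rewrite mulrCA -[X in _ < X]mulr1 ltr_pM2l //; apply: small.
  by rewrite (leq_trans cX) // leq_mul2l leq_sqr cT orbT.
have [/existsP[f /andP[fS fh]]|] := boolP [exists f : {ffun G -> 'I_N},
    (#|G| <= n.+2 * #|Z f|)%N && ~~ [exists t, hit f t]].
  exists (Z f); split => // t.
  move: fh; rewrite negb_exists => /forallP/(_ (finfun t)); rewrite negb_forall.
  move=> /existsP[z]; rewrite negb_exists => /forallP hz; exists z => i.
  by have := hz i; rewrite ffunE.
rewrite negb_exists => /forallP none.
have G0 : (0 < #|G|)%N by apply/card_gt0P; exists 0.
have := many_large_zero_sets R G n; rewrite -/N -/M.
have le : \sum_(f : {ffun G -> 'I_N}) (#|G| <= n.+2 * #|[set t | f t == ord0]|)%:R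
    <= \sum_(t : {ffun 'I_m -> G}) \sum_f (hit f t)%:R :> R.
  rewrite exchange_big /=; apply: ler_sum => f _.
  have := none f; rewrite -/(Z f); case: (_ <= _)%N => /=; last first.
    by move=> _; apply: sumr_ge0 => *; exact: ler0n.
  rewrite negbK => /existsP[t ht]; rewrite (bigD1 t) //= ht lerDl.
  by apply: sumr_ge0 => *; exact: ler0n.
move=> big; have : M < M; last by rewrite ltxx.
apply: (le_lt_trans big); apply: le_lt_trans (_ : (N * n.+2)%:R *
   \sum_(t : {ffun 'I_m -> G}) \sum_f (hit f t)%:R < _).
  by rewrite ler_wpM2l // ler0n.
rewrite mulr_sumr.
apply: (@lt_le_trans _ _ (\sum_(t : {ffun 'I_m -> G}) M / #|G|%:R ^+ m)).
  apply: ltr_sum.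
    by apply/hasP; exists [ffun=> 0]; rewrite ?mem_index_enum.
  move=> t _; rewrite ltr_pdivlMr ?exprn_gt0 ?ltr0n // mulrAC.
  exact: cov.
rewrite sumr_const card_ffun card_ord -[X in X <= _]mulr_natr natrX.
by rewrite divfK // expf_neq0 // pnatr_eq0 -lt0n.
Qed.
End Translates.

Local Open Scope classical_set_scope.
Local Open Scope ring_scope.

(** * Asymptotics of the union bound *)

Lemma near_ln_ge (R : realType) (A : R) : \forall p \near \oo, A <= ln (p%:R : R).
Proof.
near=> p.
have : expR A <= p%:R by near: p; exact: nbhs_infty_ger.
move=> h; rewrite -[A]expRK ler_ln ?posrE ?expR_gt0 //.
exact: lt_le_trans (expR_gt0 _) h.
Unshelve. all: by end_near. Qed.

Section UnionBound.
Variables (R : realType) (eps c K : R) (n : nat).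
Hypotheses (eps0 : 0 < eps) (n0 : (0 < n)%N) (c0 : 0 < c) (K0 : 0 <= K)
  (epsn : (1 - eps) * c <= (1 - eps / 2) * n%:R).
Let q : R := 1 - n.+1%:R^-1.

(** With [L = ln p] and [m <= (1 - eps) * c * L], where [c] is close to [n], the
    probability [q ^+ m] that a set of [m] points receives no zero is at least
    [p ^ (eps / 2 - 1)].  So among about [p / m ^ 2] disjoint sets the expected
    number of sets without a zero is at least [p ^ (eps / 2)] up to logarithmic factors,
    which beats the entropy [m * L] of the choice of translates; both are
    compared through [expR y >= y ^+ 5 / 5`!]. *)
Lemma union_bound_lt1 (p m r : nat) : let L : R := ln p%:R in
  1 <= L -> c ^+ 2 * (K + c) < ((eps / 2) ^+ 5 / 5`!%:R) * L ->
  (0 < m)%N -> m%:R <= (1 - eps) * c * L -> (p <= r * m ^ 2)%N ->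
  K * p%:R ^+ m * (1 - q ^+ m) ^+ r < 1.
Proof.
move=> L L1 Lbig m0 mle pr.
have L0 : 0 < L by lra.
have p0 : 0 < p%:R :> R.
  by rewrite ltNge; apply/negP => /ln0 p0; move: L0; rewrite /L p0 ltxx.
have pE : p%:R = expR L by rewrite lnK.
have nR : 0 < n%:R :> R by rewrite ltr0n.
have n1 : n.+1%:R = n%:R + 1 :> R by rewrite -natr1.
have qE : expR (- n%:R^-1) <= q.
  have -> : q = (1 + n%:R^-1)^-1.
    rewrite /q n1; field; apply/andP; split; lra.
  by rewrite expRN lef_pV2 ?posrE ?expR_gt0 ?expR_ge1Dx // addr_gt0 ?invr_gt0.
have q1 : q <= 1 by rewrite /q gerBl invr_ge0 ler0n.
have q0 : 0 < q by exact: lt_le_trans (expR_gt0 _) qE.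
have mL : m%:R / n%:R <= (1 - eps / 2) * L.
  rewrite ler_pdivrMr // (le_trans mle) //.
  rewrite [leRHS]mulrAC ler_pM2r //.
have qm : expR (- ((1 - eps / 2) * L)) <= q ^+ m.
  apply: (@le_trans _ _ (expR (- n%:R^-1) ^+ m)).
    by rewrite -expRM_natl ler_expR mulrN lerNl opprK.
  by rewrite lerXn2r // nnegrE ?expR_ge0 // ltW.
have qr : (1 - q ^+ m) ^+ r <= expR (- (q ^+ m * r%:R)).
  rewrite -mulNr expRM_natr lerXn2r ?nnegrE ?expR_ge0 ?expR_ge1Dx //.
  by rewrite subr_ge0 exprn_ile1 // ltW.
have mc : m%:R <= c * L.
  apply: (le_trans mle); rewrite ler_pM2r // ler_piMl ?(ltW c0) //.
  by rewrite gerBl ltW.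
have m2 : 0 < m%:R ^+ 2 :> R by rewrite exprn_gt0 // ltr0n.
have big : (K + m%:R * L) * m%:R ^+ 2 < q ^+ m * r%:R * m%:R ^+ 2.
  apply: (@le_lt_trans _ _ ((K + c) * c ^+ 2 * L ^+ 4)).
    have -> : (K + c) * c ^+ 2 * L ^+ 4 = ((K + c) * L ^+ 2) * (c * L) ^+ 2 by ring.
    apply: ler_pM; rewrite ?addr_ge0 ?mulr_ge0 ?ler0n ?exprn_ge0 ?(ltW L0) //.
      rewrite mulrDl lerD //.
        by rewrite ler_peMr // exprn_ege1.
      by rewrite expr2 mulrA ler_pM2r.
    by rewrite lerXn2r // nnegrE ?ler0n // mulr_ge0 // ltW.
  apply: (@lt_le_trans _ _ ((eps / 2) ^+ 5 / 5`!%:R * L * L ^+ 4)).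
    by rewrite ltr_pM2r ?exprn_gt0 // mulrC.
  apply: (@le_trans _ _ (expR (eps / 2 * L))).
    have y0 : 0 <= eps / 2 * L by rewrite mulr_ge0 ?(ltW L0) // divr_ge0 // ltW.
    have := @expR_ge1Dxn R _ 4 y0; rewrite exprMn => h.
    apply: le_trans h; rewrite -mulrA -exprS mulrAC.
    by rewrite lerDr ler01.
  have -> : expR (eps / 2 * L) = expR (- ((1 - eps / 2) * L)) * p%:R.
    by rewrite pE -expRD; congr expR; ring.
  rewrite -mulrA ler_pM ?expR_ge0 ?ler0n //.
  by rewrite -natrX -natrM ler_nat.
move: big; rewrite ltr_pM2r // => big.
apply: (@le_lt_trans _ _ (expR K * expR (L * m%:R) * expR (- (q ^+ m * r%:R)))).
  rewrite ler_pM ?mulr_ge0 ?exprn_ge0 ?ler0n //.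
    by rewrite subr_ge0 exprn_ile1 // ltW.
  rewrite ler_pM ?exprn_ge0 ?ler0n //.
    by apply: le_trans (expR_ge1Dx _); rewrite lerDr.
  by rewrite pE expRM_natr.
rewrite -!expRD -[ltRHS]expR0 ltr_expR [L * _]mulrC subr_lt0.
exact: big.
Qed.
End UnionBound.

(** The number [m] is the integer part of [(1 - eps) * n.+2 * ln p], which is
    the number of translates to be excluded when [S] has density [1 / n.+2]. *)
Lemma near_union_bound (R : realType) (eps : R) : 0 < eps -> eps <= 1 / 2 ->
  exists n : nat, \forall p \near \oo, exists m : nat,
    [/\ (0 < m)%N, (1 - eps) * ln (p%:R : R) < m.+1%:R / n.+2%:R &
     forall r, (p <= r * m ^ 2)%N ->
       (n.+1 * n.+2)%:R * p%:R ^+ m * (1 - (1 - n.+1%:R^-1) ^+ m) ^+ r < 1 :> R].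
Proof.
move=> eps0 eps1.
(* [n >= 4 / eps] makes [n.+2 / n] too close to 1 to eat up half of [eps]. *)
pose n := (Num.truncn (4 / eps)).+1; exists n.
have nbig : 4 / eps < n%:R by exact: truncnS_gt.
have epsn : (1 - eps) * n.+2%:R <= (1 - eps / 2) * n%:R.
  have : 4 < n%:R * eps by rewrite -ltr_pdivrMr.
  by rewrite -2!natr1; lra.
near=> p.
have L1 : (1 : R) <= ln p%:R by near: p; exact: near_ln_ge.
pose m := Num.truncn ((1 - eps) * n.+2%:R * ln p%:R); exists m.
have x1 : 1 <= (1 - eps) * n.+2%:R * ln p%:R.
  have n2 : 2 <= n.+2%:R :> R by rewrite ler_nat.
  rewrite -[leLHS]mulr1 ler_pM //.
  rewrite -[leLHS](_ : 1 / 2 * 2 = 1); last by lra.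
  by apply: ler_pM => //; lra.
have m0 : (0 < m)%N by rewrite truncn_gt0.
have [x0 x2] : m%:R <= (1 - eps) * n.+2%:R * ln p%:R /\
   (1 - eps) * n.+2%:R * ln p%:R < m.+1%:R.
  by apply/andP; apply: truncn_itv; lra.
split=> //; first by rewrite ltr_pdivlMr ?ltr0n // mulrAC.
move=> r; apply: (@union_bound_lt1 _ eps n.+2%:R _ n) => //.
rewrite -ltr_pdivrMl; last by rewrite divr_gt0 ?exprn_gt0 ?ltr0n ?divr_gt0.
set A := _^-1 * _; apply: (@lt_le_trans _ _ (A + 1)); first by rewrite ltrDl.
by near: p; exact: near_ln_ge.
Unshelve. all: by end_near. Qed.

(** * Intersections of subspaces and averages of projectors *)

Section Projectors.
Local Open Scope sesquilinear_scope.
Variable C : numClosedFieldType.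

Definition ortho_projector n (P : 'M[C]_n) := P ^t* = P /\ P *m P = P.

Lemma ortho_projector_exists m n (A : 'M[C]_(m, n)) :
  exists P : 'M[C]_n, [/\ ortho_projector P, \tr P = (\rank A)%:R,
    A *m P = A & (P <= A)%MS].
Proof.
pose S := schmidt (row_base A).
have SU : S *m S ^t* = 1%:M.
  by apply/unitarymxP/schmidt_unitarymx; exact: rank_leq_col.
have SA : (S :=: A)%MS.
  exact: eqmx_trans (eqmx_schmidt_free (row_base_free A)) (eq_row_base A).
exists (S ^t* *m S); split.
- split; last by rewrite mulmxA -(mulmxA _ S) SU mulmx1.
  by rewrite trmx_mul map_mxM trmxCK.
- by rewrite mxtrace_mulC SU mxtrace1.
- have /submxP[D AD] : (A <= S)%MS by rewrite SA.
  have : D *m S *m (S ^t* *m S) = D *m S by rewrite -mulmxA (mulmxA S) SU mul1mx.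
  by rewrite -AD.
- by rewrite -SA submxMl.
Qed.

Lemma trace_gram_ge0 m n (M : 'M[C]_(m, n)) : 0 <= \tr (M ^t* *m M).
Proof.
apply: sumr_ge0 => i _; rewrite mxE; apply: sumr_ge0 => j _.
by rewrite !mxE mulrC mul_conjC_ge0.
Qed.

Lemma trace_mul_projector_ge0 n (P Q : 'M[C]_n) :
  ortho_projector P -> ortho_projector Q -> 0 <= \tr (P *m Q).
Proof.
move=> [Ph PP] [Qh QQ].
suff -> : \tr (P *m Q) = \tr ((P *m Q) ^t* *m (P *m Q)) by exact: trace_gram_ge0.
rewrite trmx_mul map_mxM Ph Qh -mulmxA (mulmxA P) PP.
by rewrite [RHS]mxtrace_mulC -mulmxA QQ.
Qed.

Lemma ortho_projector_absorbC n (P K : 'M[C]_n) :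
  ortho_projector P -> ortho_projector K -> K *m P = K -> P *m K = K.
Proof.
move=> [Ph _] [Kh _] /(congr1 (fun M => M ^t*)).
by rewrite trmx_mul map_mxM Ph Kh.
Qed.

Lemma ortho_projectorB n (P K : 'M[C]_n) :
  ortho_projector P -> ortho_projector K -> K *m P = K -> ortho_projector (P - K).
Proof.
move=> Pp Kp KP; have PK := ortho_projector_absorbC Pp Kp KP.
case: Pp Kp => [Ph PP] [Kh KK]; split.
  by rewrite [(_ - _)^T]raddfB /= map_mxB Ph Kh.
by rewrite mulmxBl !mulmxBr PP KK KP PK subrr subr0.
Qed.

(** Let [K] be the projector onto the intersection.  Then [P - K] and [Q - K] are
    orthogonal projectors, and [\tr (P *m Q) = \tr K + \tr ((P - K) *m (Q - K))]
    with a nonnegative last term. *)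
Lemma rank_cap_le_trace m m' n (A : 'M[C]_(m, n)) (B : 'M[C]_(m', n)) (P Q : 'M[C]_n) :
  ortho_projector P -> ortho_projector Q -> A *m P = A -> B *m Q = B ->
  (\rank (A :&: B)%MS)%:R <= \tr (P *m Q).
Proof.
move=> Pp Qp AP BQ.
have [K [Kp trK _ KAB]] := ortho_projector_exists (A :&: B)%MS.
have KP : K *m P = K.
  have /submxP[D ->] := submx_trans KAB (capmxSl _ _).
  by rewrite -mulmxA AP.
have KQ : K *m Q = K.
  have /submxP[D ->] := submx_trans KAB (capmxSr _ _).
  by rewrite -mulmxA BQ.
have PK := ortho_projector_absorbC Pp Kp KP.
have := trace_mul_projector_ge0 (ortho_projectorB Pp Kp KP) (ortho_projectorB Qp Kp KQ).
rewrite mulmxBl !mulmxBr KQ PK; case: Kp => _ ->.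
by rewrite subrr subr0 raddfB /= trK subr_ge0.
Qed.

Section Average.
Variables (n : nat) (I : finType) (G : I -> 'M[C]_n) (c : C).
Hypotheses (unitG : forall i, G i *m (G i) ^t* = 1%:M)
  (schurG : forall M, \sum_i (G i) ^t* *m M *m G i = (c * \tr M)%:M).

(** A projector onto the row space of [B *m G i] is the conjugate of a projector
    onto that of [B]; averaging it gives a scalar matrix, so the traces
    bounding the ranks can be computed. *)
Lemma average_rank_cap m m' (A : 'M[C]_(m, n)) (B : 'M[C]_(m', n)) :
  \sum_i (\rank (A :&: (B *m G i))%MS)%:R <= c * (\rank A * \rank B)%:R.
Proof.
have [P [Pp trP AP _]] := ortho_projector_exists A.
have [Q [[Qh QQ] trQ BQ _]] := ortho_projector_exists B.
apply: (@le_trans _ _ (\sum_i \tr (P *m ((G i) ^t* *m Q *m G i)))).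
  apply: ler_sum => i _; apply: rank_cap_le_trace => //.
  - split; first by rewrite !trmx_mul !map_mxM Qh trmxCK mulmxA.
    by rewrite !mulmxA -(mulmxA _ (G i)) unitG mulmx1 -(mulmxA _ Q Q) QQ.
  - by rewrite !mulmxA -(mulmxA _ (G i)) unitG mulmx1 BQ.
rewrite -raddf_sum -mulmx_sumr schurG trQ mul_mx_scalar /= mxtraceZ trP natrM.
by rewrite -mulrA [_ * (\rank A)%:R]mulrC.
Qed.

Lemma card_schur : (0 < n)%N -> c * n%:R = #|I|%:R.
Proof.
move=> n0; have := congr1 mxtrace (schurG 1%:M); rewrite raddf_sum /=.
rewrite (eq_bigr (fun=> n%:R)) => [|i _]; last first.
  by rewrite mulmx1 mxtrace_mulC unitG mxtrace1.
rewrite sumr_const mxtrace1 mxtrace_scalar => h.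
have n0C : n%:R != 0 :> C by rewrite pnatr_eq0 -lt0n.
by apply: (mulIf n0C); rewrite [LHS]mulr_natr -h mulr_natl.
Qed.

Lemma exists_small_cap m m' (A : 'M[C]_(m, n)) (B : 'M[C]_(m', n)) :
  (0 < #|I|)%N ->
  exists i, (n * \rank (A :&: (B *m G i))%MS <= \rank A * \rank B)%N.
Proof.
move=> I0; apply/existsP; apply: contraLR isT => /existsPn h.
have [n0|n0] := posnP n.
  have z k : (n * k = 0)%N by rewrite n0.
  by case/card_gt0P: I0 => i _; have := h i; rewrite z.
have := average_rank_cap A B; rewrite -natr_sum.
set r := (\rank A * _)%N; set s := (\sum_i _)%N => le.
have : (n * s <= #|I| * r)%N.
  rewrite -(ler_nat C) (natrM _ n s) (natrM _ #|I| r) -card_schur // mulrAC [leLHS]mulrC.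
  by rewrite ler_wpM2r ?ler0n.
rewrite -sum_nat_const leqNgt /s big_distrr /= => /negP[].
case/card_gt0P: I0 => i0 _.
rewrite (bigD1 i0) //= [X in (_ < X)%N](bigD1 i0) //= -addSn leq_add //.
  by rewrite ltnNge h.
by apply: leq_sum => i _; rewrite ltnW // ltnNge h.
Qed.
End Average.
End Projectors.

Section Transfer.
Local Open Scope sesquilinear_scope.
Variables (C : numClosedFieldType) (V : vectType C) (n : nat).
Variables (rho : {linear V -> 'rV[C]_n}) (rho_inj : injective rho).

Definition mx_of_space (U : {vspace V}) : 'M[C]_(\dim U, n) :=
  \matrix_i rho (vbasis U)`_i.

Lemma sub_mx_of_space (U : {vspace V}) v : v \in U -> (rho v <= mx_of_space U)%MS.
Proof.
move=> /coord_vbasis ->; rewrite linear_sum; apply: summx_sub => i _.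
rewrite linearZ scalemx_sub //.
by rewrite -[X in (X <= _)%MS](rowK (fun i : 'I_(\dim U) => rho (vbasis U)`_i)) row_sub.
Qed.

Lemma rank_mx_of_space U : \rank (mx_of_space U) = \dim U.
Proof.
apply/eqP; rewrite -[_ == _]/(row_free _); apply: inj_row_free => v.
rewrite mulmx_sum_row => h.
have : \sum_i v 0 i *: (vbasis U)`_i = 0.
  apply: rho_inj; rewrite linear0 linear_sum -[RHS]h; apply: eq_bigr => i _.
  by rewrite linearZ rowK.
have /freeP fr := basis_free (vbasisP U).
by move=> /fr vi; apply/rowP => i; rewrite vi mxE.
Qed.

Variables (I : finType) (g : I -> 'End(V)) (G : I -> 'M[C]_n) (c : C).
Hypotheses (unitG : forall i, G i *m (G i) ^t* = 1%:M)
  (schurG : forall M, \sum_i (G i) ^t* *m M *m G i = (c * \tr M)%:M)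
  (I0 : (0 < #|I|)%N)
  (gG : forall i v, rho (g i v) = rho v *m G i).

(** The matrix statement applied to the row spaces of the images under [rho] of
    bases of [W] and [U]. *)
Lemma exists_small_capv (W U : {vspace V}) :
  exists i, (n * \dim (W :&: (g i @: U)) <= \dim W * \dim U)%N.
Proof.
have [i h] := exists_small_cap unitG schurG (mx_of_space W) (mx_of_space U) I0.
exists i; move: h; rewrite !rank_mx_of_space; apply: leq_trans.
rewrite leq_mul2l -rank_mx_of_space; apply/orP; right; apply: mxrankS.
apply/row_subP => j; rewrite rowK.
have : (vbasis (W :&: g i @: U))`_j \in (W :&: g i @: U)%VS.
  by apply/vbasis_mem/mem_nth; rewrite size_tuple.
rewrite memv_cap sub_capmx => /andP[/sub_mx_of_space -> /memv_imgP[u uU ->]].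
by rewrite gG submxMr // sub_mx_of_space.
Qed.
End Transfer.

Section Iterate.
Variables (K : fieldType) (V : vectType K) (H : 'End(V) -> Prop) (U : {vspace V}).
Let n := \dim {:V}.
Hypothesis kerH : forall g, H g -> lker g = 0%VS.
Hypothesis small_cap : forall W : {vspace V}, exists g : 'End(V),
  H g /\ (n * \dim (W :&: (g @: U)) <= \dim W * \dim U)%N.

(** Each new translate chosen by [small_cap] multiplies the codimension by at most
    [(n - \dim U) / n]; the inequality is this bound for [m] translates, with
    denominators cleared. *)
Lemma iterate_cover m : exists g : 'I_m -> 'End(V), (forall i, H (g i)) /\
  ((n - \dim (\sum_(i < m) g i @: U)) * n ^ m <= n * (n - \dim U) ^ m)%N.
Proof.
elim: m => [|m [g [Hg le]]].
  exists (fun=> \1%VF); split=> [[]//|].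
  by rewrite big_ord0 dimv0 subn0 !expn0.
set W := (\sum_(i < m) _)%VS in le.
have [h [Hh leh]] := small_cap W.
exists (fun i : 'I_m.+1 => if unlift ord0 i is Some j then g j else h); split.
  by move=> i; case: (unlift _ i).
rewrite big_ord_recl unlift_none.
under eq_bigr do rewrite liftK.
rewrite -/W addvC.
have hU : \dim (h @: U) = \dim U by apply: limg_dim_eq; rewrite kerH // capv0.
have Wn : (\dim W <= n)%N := dimvS (subvf W).
have Un : (\dim U <= n)%N := dimvS (subvf U).
have capn : (\dim (W :&: (h @: U)) <= \dim U)%N by rewrite -hU dimvS // capvSr.
have sumn : (\dim (W + h @: U) <= n)%N := dimvS (subvf _).
have := dimv_sum_cap W (h @: U); rewrite hU => sumE.
have step : ((n - \dim (W + h @: U)) * n <= (n - \dim W) * (n - \dim U))%N by nia.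
rewrite !expnS mulnA (leq_trans (leq_mul step (leqnn _))) //.
by rewrite mulnAC [X in (_ <= X)%N]mulnCA mulnC leq_mul2l le orbT.
Qed.

Lemma exists_cover m : (n * (n - \dim U) ^ m < n ^ m)%N ->
  exists g : 'I_m -> 'End(V), (forall i, H (g i)) /\
    (\sum_(i < m) g i @: U)%VS = {:V}%VS.
Proof.
move=> small; have [g [Hg le]] := iterate_cover m; exists g; split=> //.
apply/eqP; rewrite eqEdim subvf /= -subn_eq0 -/n.
move: (leq_ltn_trans le small); set x := (n - _)%N.
by case: x => // x; rewrite ltnNge leq_pmull.
Qed.
End Iterate.

(** * The Weyl matrices *)

Section Weyl.
Local Open Scope sesquilinear_scope.
Variables (C : numClosedFieldType) (k : nat) (w : C).
Let N := k.+2.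
Hypothesis prim : N.-primitive_root w.

(** The matrices of the operators [Z^b X^a], acting on row vectors on the
    right. *)
Definition weyl_mx (ab : 'I_N * 'I_N) : 'M[C]_N :=
  \matrix_(i, j) (w ^+ (ab.2 * j) * (j == i + ab.1)%:R).

Lemma mul_weyl_mx m (M : 'M[C]_(m, N)) ab i j :
  (M *m weyl_mx ab) i j = M i (j - ab.1) * w ^+ (ab.2 * j).
Proof.
rewrite mxE (bigD1 (j - ab.1)) //= big1 => [|l ne].
  by rewrite addr0 mxE subrK eqxx mulr1.
by rewrite mxE -subr_eq eq_sym (negbTE ne) !mulr0.
Qed.

Lemma mul_weyl_mxtC m (M : 'M[C]_(N, m)) ab i j :
  ((weyl_mx ab) ^t* *m M) i j = (w ^+ (ab.2 * i))^* * M (i - ab.1) j.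
Proof.
rewrite mxE (bigD1 (i - ab.1)) //= big1 => [|l ne].
  by rewrite addr0 !mxE subrK eqxx mulr1.
by rewrite !mxE -subr_eq eq_sym (negbTE ne) mulr0 conjC0 mul0r.
Qed.

Lemma prim_root_neq0 : w != 0.
Proof.
apply/negP => /eqP w0; have := prim_expr_order prim.
by rewrite w0 expr0n /= => /eqP; rewrite eq_sym oner_eq0.
Qed.

Lemma conj_prim_root n : (w ^+ n)^* = (w ^+ n)^-1.
Proof.
have w1 : `|w| = 1.
  apply/eqP; rewrite -(@pexpr_eq1 _ _ N) //.
  by rewrite -normrX (prim_expr_order prim) normr1.
by rewrite invC_norm normrX w1 expr1n expr1n invr1 mul1r.
Qed.

Lemma weyl_mx_unitary ab : weyl_mx ab *m (weyl_mx ab) ^t* = 1%:M.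
Proof.
apply: mulmx1C; apply/matrixP => i j; rewrite mul_weyl_mxtC !mxE subrK.
rewrite conj_prim_root eq_sym.
case: eqP => [->|_]; last by rewrite !mulr0.
by rewrite mulr1 mulVf // expf_neq0 // prim_root_neq0.
Qed.

(** Orthogonality of the characters of the cyclic group. *)
Lemma sum_char (i j : 'I_N) :
  \sum_(b < N) (w ^+ (b * i))^* * w ^+ (b * j) = N%:R * (i == j)%:R.
Proof.
under eq_bigr => b _ do
  rewrite conj_prim_root (mulnC b) (mulnC b) !exprM -exprVn -exprMn.
set z := _ * _; case: eqP => [ij|/eqP ij].
  have -> : z = 1 by rewrite /z ij mulVf // expf_neq0 // prim_root_neq0.
  by under eq_bigr do rewrite expr1n; rewrite sumr_const card_ord mulr1.
have z1 : z != 1.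
  apply: contra ij => /eqP; rewrite /z mulrC => /divr1_eq/eqP.
  by rewrite (eq_prim_root_expr prim) !modn_small // eq_sym.
rewrite mulr0; apply: (mulfI (x := z - 1)); first by rewrite subr_eq0.
rewrite mulr0 -subrX1 /z exprMn exprVn -!exprM ![(_ * N)%N]mulnC !exprM.
by rewrite (prim_expr_order prim) !expr1n invr1 mulr1 subrr.
Qed.

(** Schur's lemma made explicit: summing over [b] kills the off-diagonal entries
    of [M] and summing over [a] averages the diagonal ones. *)
Lemma weyl_mx_schur (M : 'M[C]_N) :
  \sum_ab (weyl_mx ab) ^t* *m M *m weyl_mx ab = (N%:R * \tr M)%:M.
Proof.
apply/matrixP => i j; rewrite summxE.
under eq_bigr => ab _ do rewrite mul_weyl_mx mul_weyl_mxtC.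
rewrite -(pair_bigA _ (fun a b : 'I_N =>
   (w ^+ (b * i))^* * M (i - a) (j - a) * w ^+ (b * j))) /=.
under eq_bigr => a _.
  under eq_bigr => b _ do rewrite mulrAC.
  rewrite -mulr_suml sum_char.
  over.
rewrite !mxE; case: eqP => [->|_]; last first.
  by rewrite big1 // => a _; rewrite mulr0 mul0r.
rewrite mulr1n -mulr_sumr mulr1; congr (_ * _).
rewrite /mxtrace (reindex_inj (h := fun a => j - a)) //=.
  by apply: eq_bigr => a _; rewrite subKr.
by move=> a b /addrI/oppr_inj.
Qed.
End Weyl.

(** * The Schroedinger representation *)

Lemma omega_exp (R : realType) (p n : nat) : omega R p ^+ n =
  Complex (cos (n%:R * (2 * pi / p%:R))) (sin (n%:R * (2 * pi / p%:R))).
Proof.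
elim: n => [|n IH]; first by rewrite expr0 mul0r cos0 sin0.
rewrite exprSr IH /omega; set s := 2 * _ / _; set t := _ * s.
have -> : n.+1%:R * s = t + s by rewrite -(natr1 n) mulrDl mul1r.
rewrite cosD sinD.
by apply/eqP; rewrite eq_complex /= eqxx /= [X in _ == X]addrC.
Qed.

Lemma omega_prim (R : realType) (p : nat) : (0 < p)%N ->
  p.-primitive_root (omega R p).
Proof.
move=> p0; have pR : 0 < p%:R :> R by rewrite ltr0n.
apply/andP; split=> //; apply/forallP => i; apply/eqP.
rewrite unity_rootE omega_exp.
have [ip|ip] := eqVneq i.+1 p.
  rewrite ip mulrC divfK; last by rewrite gt_eqF.
  by rewrite mulr_natl cos2pi sin2pi; exact: eqxx.
apply: negbTE; apply/negP => /eqP[c1 _].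
have ilt : (i.+1 < p)%N by rewrite ltn_neqAle ip ltn_ord.
(* The real part is 1 - 2 (sin x)^2 for the half angle x, which lies strictly
   between 0 and pi. *)
pose x : R := i.+1%:R * pi / p%:R.
have xE : i.+1%:R * (2 * pi / p%:R) = x *+ 2.
  by rewrite /x -mulr_natr; ring.
have s0 : 0 < sin x.
  apply: sin_gt0_pi; rewrite /x divr_gt0 ?mulr_gt0 ?pi_gt0 ?ltr0n //=.
  by rewrite ltr_pdivrMr // mulrC ltr_pM2l ?pi_gt0 // ltr_nat.
move: c1; rewrite xE cos_mulr2n => c1; have := cos2Dsin2 x.
have := exprn_gt0 2 s0; rewrite -mulr_natr in c1; lra.
Qed.

Section Heisenberg.
Variables (R : realType) (p : nat).
Local Notation C := R[i].
Local Notation GA := (group_algebra R p).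

Definition coef (j : 'F_p) (v : GA) : C := (v : {ffun 'F_p -> R[i]^o}) j.

Lemma coefD j u v : coef j (u + v) = coef j u + coef j v.
Proof. by rewrite /coef ffunE. Qed.

Lemma coefZ j a v : coef j (a *: v) = a * coef j v.
Proof. by rewrite /coef ffunE. Qed.

Lemma coef_sum j (I : Type) (r : seq I) (P : pred I) (F : I -> GA) :
  coef j (\sum_(i <- r | P i) F i) = \sum_(i <- r | P i) coef j (F i).
Proof. by rewrite /coef sum_ffunE. Qed.

Lemma coef_basis j k : coef j (basis_vec R k) = (j == k)%:R.
Proof. by rewrite /coef ffunE. Qed.

Lemma coef_inj u v : (forall j, coef j u = coef j v) -> u = v.
Proof. by move=> h; apply/ffunP. Qed.

Lemma coef_linear_extension f v j :
  coef j (linear_extension f v) = \sum_k coef k v * coef j (f k).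
Proof.
rewrite [in LHS](group_algebra_sum v) linear_sum coef_sum; apply: eq_bigr => k _.
by rewrite linearZ /= coefZ linear_extension_basis.
Qed.

Lemma coef_heisX v j : coef j (heisX R p v) = coef (j - 1) v.
Proof.
rewrite coef_linear_extension (bigD1 (j - 1)) //= big1 => [|k kj].
  by rewrite addr0 coef_basis subrK eqxx mulr1.
by rewrite coef_basis -subr_eq eq_sym (negbTE kj) mulr0.
Qed.

Lemma coef_heisZ v j : coef j (heisZ R p v) = omega R p ^+ j * coef j v.
Proof.
rewrite coef_linear_extension (bigD1 j) //= big1 => [|k kj].
  by rewrite addr0 coefZ coef_basis eqxx mulr1 mulrC.
by rewrite coefZ coef_basis eq_sym (negbTE kj) !mulr0.
Qed.

Definition shift_scaling (g : 'End(GA)) (t : 'F_p) (c : 'F_p -> C) :=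
  (forall j, c j != 0) /\ forall v j, coef j (g v) = c j * coef (j - t) v.

(** Only the support matters for coordinate subspaces: every element of the
    group is a weighted shift, since weighted shifts form a linear group
    containing both generators. *)
Lemma heisenberg_shift_scaling g : heisenberg R p g ->
  exists t c, shift_scaling g t c.
Proof.
move=> Hg; apply: (Hg [set g | exists t c, shift_scaling g t c]%classic).
split; first split.
- move=> h [t [c [c0 hE]]]; apply/eqP/lker0P => u v uv; apply: coef_inj => j.
  have := congr1 (coef (j + t)) uv; rewrite !hE addrK.
  exact: mulfI.
- exists 0, (fun=> 1); split=> [j|v j]; first exact: oner_neq0.
  by rewrite id_lfunE subr0 mul1r.
- move=> h k [t [c [c0 hE]]] [s [d [d0 kE]]].
  exists (t + s), (fun j => c j * d (j - t)); split=> [j|v j].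
    by rewrite mulf_neq0.
  by rewrite comp_lfunE hE kE mulrA -addrA opprD.
- move=> h [t [c [c0 hE]]]; exists (- t), (fun j => (c (j + t))^-1).
  split=> [j|v j]; first by rewrite invr_eq0.
  have h0 : lker h == 0%VS.
    apply/lker0P => u w uw; apply: coef_inj => i.
    have := congr1 (coef (i + t)) uw; rewrite !hE addrK.
    exact: mulfI.
  rewrite opprK -[in RHS](lker0_lfunVK h0 v) hE addrK.
  by rewrite mulKf.
- move=> _ [->|->].
  + exists 1, (fun=> 1); split=> [j|v j]; first exact: oner_neq0.
    by rewrite coef_heisX mul1r.
  + exists 0, (fun j : 'F_p => omega R p ^+ j); split=> [j|v j].
      by rewrite expf_neq0 // omega_neq0.
    by rewrite coef_heisZ subr0.
Qed.

Lemma heisenberg_weyl (ab : 'F_p * 'F_p) : exists g, heisenberg R p g /\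
  forall v j, coef j (g v) = omega R p ^+ (ab.2 * j) * coef (j - ab.1) v.
Proof.
have [_ H1 HM _] := @heisenberg_linear_group R p.
have HX : heisenberg R p (heisX R p) by move=> M [_]; apply; left.
have HZ : heisenberg R p (heisZ R p) by move=> M [_]; apply; right.
have [x [Hx xE]] : exists x, heisenberg R p x /\
    forall v j, coef j (x v) = coef (j - ab.1) v.
  rewrite -[ab.1]natr_Zp; elim: (nat_of_ord ab.1) => [|a [x [Hx xE]]].
    by exists \1%VF; split=> // v j; rewrite id_lfunE subr0.
  exists (heisX R p \o x)%VF; split; first exact: HM.
  by move=> v j; rewrite comp_lfunE coef_heisX xE -natr1 opprD addrA addrAC.
elim: (nat_of_ord ab.2) => [|b [g [Hg gE]]].
  by exists x; split=> // v j; rewrite mul0n expr0 mul1r.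
exists (heisZ R p \o g)%VF; split; first exact: HM.
by move=> v j; rewrite comp_lfunE coef_heisZ gE mulrA -exprD -mulSn.
Qed.

Lemma dim_group_algebra : \dim {:GA} = #|'F_p|.
Proof. by rewrite dimvf /dim /= muln1. Qed.

Lemma coord_subspace_coef (S : {set 'F_p}) v j :
  v \in coord_subspace R S -> j \notin S -> coef j v = 0.
Proof.
move=> /memv_sumP[u uS ->] jS; rewrite coef_sum big1 // => s sS.
have /vlineP[a ->] := uS s sS; rewrite coefZ coef_basis.
by case: eqP jS => [->|_ _]; rewrite ?sS ?mulr0.
Qed.

(** The coordinate subspaces of [S] and of its complement span the space, and
    each has dimension at most the size of its index set. *)
Lemma dim_coord_subspace_ge (S : {set 'F_p}) : (#|S| <= \dim (coord_subspace R S))%N.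
Proof.
have le (T : {set 'F_p}) : (\dim (coord_subspace R T) <= #|T|)%N.
  rewrite (leq_trans (dimv_leq_sum _ _ _)) // -sum1_card.
  by apply: leq_sum => s _; rewrite dim_vline leq_b1.
have full : (coord_subspace R S + coord_subspace R (~: S) = {:GA})%VS.
  apply/eqP; rewrite eqEsubv subvf /=; apply/subvP => v _.
  rewrite (group_algebra_sum v) (bigID (mem S)) /= memv_add //.
    by apply: memv_sumr => s sS; rewrite memvZ // memv_line.
  rewrite /coord_subspace (eq_bigl (fun s => s \notin S)); last by move=> s; rewrite inE.
  by apply: memv_sumr => s sS; rewrite memvZ // memv_line.
have := dimv_add_leqif (coord_subspace R S) (coord_subspace R (~: S)).
move=> [h _]; move: h; rewrite full dim_group_algebra -(cardsC S).
move=> /leq_trans/(_ (leq_add (leqnn _) (le _))).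
by rewrite leq_add2r.
Qed.

(** A weighted shift by [t] sends the coordinate subspace of [S] into that of
    [S + t]; a coordinate missed by all the shifted sets would vanish on the
    whole space. *)
Lemma coord_subspace_covers (S : {set 'F_p}) m :
  covers (heisenberg R p) (coord_subspace R S) m ->
  exists t : 'I_m -> 'F_p, forall z, exists i, z - t i \in S.
Proof.
move=> [g [Hg full]].
have /choice[t tP] : forall i, exists t, exists c, shift_scaling (g i) t c.
  by move=> i; exact: heisenberg_shift_scaling.
exists t => z; apply: contrapT => none.
have : basis_vec R z \in (\sum_(i < m) g i @: coord_subspace R S)%VS.
  by rewrite full memvf.
move=> /memv_sumP[u ug /(congr1 (coef z))].
rewrite coef_basis eqxx coef_sum big1; first by move/eqP; rewrite oner_eq0.
move=> i _; have /memv_imgP[w wS ->] := ug i isT.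
have [c [_ ->]] := tP i.
rewrite (coord_subspace_coef wS) ?mulr0 //.
by apply/negP => h; apply: none; exists i.
Qed.

Definition coef_row (v : GA) : 'rV[C]_(Zp_trunc (pdiv p)).+2 := \row_j coef j v.

Lemma coef_row_linear : linear coef_row.
Proof. by move=> a u v; apply/rowP => j; rewrite !mxE coefD coefZ. Qed.

Hypothesis pr_p : prime p.

Lemma heisenberg_small_cap (W U : {vspace GA}) : exists g, heisenberg R p g /\
  (p * \dim (W :&: (g @: U)) <= \dim W * \dim U)%N.
Proof.
pose HF := GRing.isLinear.Build _ _ _ _ coef_row coef_row_linear.
pose rho : {linear GA -> 'rV[C]_(Zp_trunc (pdiv p)).+2} := HB.pack coef_row HF.
have rho_inj : injective rho.
  by move=> u v /rowP h; apply: coef_inj => j; have := h j; rewrite !mxE.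
have prim : (Zp_trunc (pdiv p)).+2.-primitive_root (omega R p).
  by rewrite Fp_cast //; apply: omega_prim; exact: prime_gt0.
have /choice[g gP] := heisenberg_weyl.
have [||ab h] := @exists_small_capv C GA _ rho rho_inj _ g (weyl_mx (omega R p))
   _ (weyl_mx_unitary prim) (weyl_mx_schur prim) _ _ W U.
- by apply/card_gt0P; exists (0, 0).
- move=> ab v; apply/rowP => j; rewrite mul_weyl_mx !mxE.
  by have [_ ->] := gP ab; rewrite mulrC.
exists (g ab); split; first by case: (gP ab).
by move: h; rewrite Fp_cast.
Qed.

Lemma heisenberg_covers (U : {vspace GA}) m :
  (p * (p - \dim U) ^ m < p ^ m)%N -> covers (heisenberg R p) U m.
Proof.
move=> small.
have kerH g : heisenberg R p g -> lker g = 0%VS.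
  by case: (@heisenberg_linear_group R p) => + _ _ _; apply.
have dimV : \dim {:GA} = p by rewrite dim_group_algebra card_Fp.
have := @exists_cover C GA (heisenberg R p) U kerH.
rewrite dimV; apply=> // W; exact: heisenberg_small_cap.
Qed.
End Heisenberg.

(** * Group-additive diameters *)

Lemma diam_plus_min (R : realType) (V : vectType R[i]) (H : set 'End(V))
    (U : {vspace V}) m : covers H U m ->
  covers H U (diam_plus H U) /\ (diam_plus H U <= m)%N.
Proof.
move=> Hm; rewrite /diam_plus; case: pselect => [ex|[]]; last first.
  by exists m; apply/asboolP.
case: ex_minnP => d /asboolP Hd mind; split=> //.
by apply: mind; apply/asboolP.
Qed.

Section Diameter.
Variables (R : realType) (p : nat).
Hypothesis pr_p : prime p.
Local Notation GA := (group_algebra R p).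
Local Notation H := (heisenberg R p).

Lemma dim_prime_group_algebra : \dim {:GA} = p.
Proof. by rewrite dim_group_algebra card_Fp. Qed.

Lemma pR_gt0 : 0 < p%:R :> R.
Proof. by rewrite ltr0n prime_gt0. Qed.

Lemma ln_p_ge0 : 0 <= ln p%:R :> R.
Proof. by apply: ln_ge0; rewrite ler1n prime_gt0. Qed.

Lemma codim_bound_lt1 (u m : nat) : (0 < u <= p)%N ->
  p%:R / u%:R * ln p%:R < m%:R :> R -> (p * (p - u) ^ m < p ^ m)%N.
Proof.
move=> /andP[u0 up] mbig; have p0 := pR_gt0.
rewrite -(ltr_nat R) natrM !natrX natrB //.
have -> : p%:R - u%:R = p%:R * (1 - u%:R / p%:R) :> R by field; rewrite gt_eqF.
rewrite exprMn mulrCA -[ltRHS]mulr1 ltr_pM2l ?exprn_gt0 //.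
rewrite mulrC -ltr_pdivlMr // div1r.
apply: (@le_lt_trans _ _ (expR (- (u%:R / p%:R * m%:R)))).
  set a : R := u%:R / p%:R.
  rewrite -[- (a * _)]mulNr expRM_natr lerXn2r ?nnegrE ?expR_ge0 ?expR_ge1Dx //.
  by rewrite subr_ge0 ler_pdivrMr // mul1r ler_nat.
rewrite [ltRHS](_ : _ = expR (- ln p%:R)); last by rewrite expRN lnK.
rewrite ltr_expR ltrN2 mulrAC ltr_pdivlMr // mulrC [ltRHS]mulrC.
by rewrite -ltr_pdivrMr ?ltr0n // mulrAC.
Qed.

(** The codimension left by [m] well-chosen translates is at most
    [p * (1 - u / p) ^+ m] with [u = \dim U], and an integer below 1 is 0. *)
Lemma heisenberg_diam (U : {vspace GA}) : U <> 0%VS ->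
  covers H U (diam_plus H U) /\
  (diam_plus H U)%:R <= p%:R / (\dim U)%:R * ln p%:R + 1 :> R.
Proof.
move=> U0.
have u0 : (0 < \dim U)%N by rewrite lt0n dimv_eq0; apply/eqP.
have up : (\dim U <= p)%N by move: (dimvS (subvf U)); rewrite dim_prime_group_algebra.
set x := _ * ln _; have x0 : 0 <= x by rewrite mulr_ge0 ?divr_ge0 ?ler0n ?ln_p_ge0.
have small : (p * (p - \dim U) ^ (Num.truncn x).+1 < p ^ (Num.truncn x).+1)%N.
  by apply: codim_bound_lt1; rewrite ?u0 ?up ?truncnS_gt.
have [cU le] := diam_plus_min (heisenberg_covers pr_p small).
split=> //.
apply: (@le_trans _ _ (Num.truncn x).+1%:R); first by rewrite ler_nat.
by rewrite -natr1 lerD2r truncn_le.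
Qed.

Lemma relative_diam_le (U : {vspace GA}) : U <> 0%VS ->
  relative_diam H U <= ln p%:R + 1.
Proof.
move=> U0; have [_ le] := heisenberg_diam U0.
have u0 : (0 < \dim U)%N by rewrite lt0n dimv_eq0; apply/eqP.
have up : (\dim U <= p)%N by move: (dimvS (subvf U)); rewrite dim_prime_group_algebra.
rewrite /relative_diam dim_prime_group_algebra; set x := p%:R / _ in le *.
have x1 : 1 <= x by rewrite ler_pdivlMr ?ltr0n // mul1r ler_nat.
have xc : x <= (Num.ceil x)%:~R by exact: ceil_ge.
have c0 : 0 < (Num.ceil x)%:~R :> R by apply: lt_le_trans xc; lra.
rewrite ler_pdivrMr // (le_trans le) // mulrDl mul1r mulrC.
by rewrite lerD ?(le_trans x1) // ler_wpM2l // ln_p_ge0.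
Qed.

(** The relative diameter of [U] depends only on its diameter and its dimension,
    and both are bounded; so the maximum is attained. *)
Lemma covering_complexity_max :
  [set relative_diam H U | U in [set U : {vspace GA} | U <> 0%VS]]
    (covering_complexity H) /\
  forall U : {vspace GA}, U <> 0%VS -> relative_diam H U <= covering_complexity H.
Proof.
set A := [set relative_diam H U | U in _].
suff : (A `&` ubound A) (covering_complexity H).
  by move=> [? ub]; split=> // U U0; apply: ub; exists U.
apply: xgetPex.
pose D := Num.truncn (p%:R * ln p%:R + 1 : R).
pose F (d : 'I_D.+1 * 'I_p.+1) : R := d.1%:R / (Num.ceil (p%:R / d.2%:R : R))%:~R.
pose P d := `[< exists U : {vspace GA}, [/\ U <> 0%VS, F d = relative_diam H U &
   diam_plus H U = d.1 /\ \dim U = d.2] >].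
have PU (U : {vspace GA}) : U <> 0%VS -> exists2 d, P d & F d = relative_diam H U.
  move=> U0; have [_ le] := heisenberg_diam U0.
  have u0 : (0 < \dim U)%N by rewrite lt0n dimv_eq0; apply/eqP.
  have up : (\dim U < p.+1)%N by move: (dimvS (subvf U)); rewrite dim_prime_group_algebra ltnS.
  have dD : (diam_plus H U < D.+1)%N.
    rewrite ltnS truncn_ge_nat; last first.
      by rewrite addr_ge0 // mulr_ge0 ?ler0n ?ln_p_ge0.
    apply: (le_trans le); rewrite lerD2r ler_wpM2r ?ln_p_ge0 //.
    by rewrite ler_pdivrMr ?ltr0n // ler_peMr ?ler1n ?ler0n.
  have FU : F (Ordinal dD, Ordinal up) = relative_diam H U.
    by rewrite /relative_diam dim_prime_group_algebra.
  by exists (Ordinal dD, Ordinal up) => //; apply/asboolP; exists U.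
have V0 : ({:GA})%VS <> 0%VS.
  by move/eqP; rewrite -dimv_eq0 dim_prime_group_algebra => /eqP p0; move: pr_p; rewrite p0.
have [d0 Pd0 _] := PU _ V0.
case: (arg_maxP F Pd0) => d /asboolP[U [U0 FU _]] maxd.
exists (F d); split; first by exists U.
by move=> _ [W W0 <-]; have [e Pe <-] := PU W W0; exact: maxd.
Qed.

Lemma covering_complexity_le : covering_complexity H <= ln p%:R + 1.
Proof. by have [[U U0 <-] _] := covering_complexity_max; exact: relative_diam_le. Qed.

Lemma relative_diam_coord_ge (S : {set 'F_p}) (m k : nat) :
  (p <= k * #|S|)%N ->
  (forall t : 'I_m -> 'F_p, exists z, forall i, z - t i \notin S) ->
  coord_subspace R S <> 0%VS /\
  m.+1%:R / k%:R <= relative_diam H (coord_subspace R S).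
Proof.
move=> pkS hard; have p0 := prime_gt0 pr_p.
have := leq_trans p0 pkS; rewrite muln_gt0 => /andP[k0 S0].
have u0 := leq_trans S0 (dim_coord_subspace_ge R S).
have U0 : coord_subspace R S <> 0%VS.
  by move/eqP; rewrite -dimv_eq0 eqn0Ngt u0.
split=> //; have [cU _] := heisenberg_diam U0.
have dm : (m < diam_plus H (coord_subspace R S))%N.
  rewrite ltnNge; apply/negP => dm.
  (* A family of at most [m] translates is completed by arbitrary ones. *)
  have [t tP] := coord_subspace_covers cU.
  have [z zP] := hard (fun i => oapp t 0 (insub (val i))).
  have [i ziS] := tP z.
  have := zP (widen_ord dm i); rewrite /= insubT //= => lt.
  by rewrite (_ : Sub _ _ = i) ?ziS //; exact: val_inj.
rewrite /relative_diam dim_prime_group_algebra.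
set x := p%:R / _; have xk : x <= k%:R.
  rewrite ler_pdivrMr ?ltr0n // -natrM ler_nat (leq_trans pkS) //.
  by rewrite leq_mul2l dim_coord_subspace_ge orbT.
have x0 : 0 < x by rewrite divr_gt0 ?ltr0n.
have c0 : 0 < (Num.ceil x)%:~R :> R by apply: (lt_le_trans x0); exact: ceil_ge.
apply: ler_pM; rewrite ?ler0n ?invr_ge0 ?ler0n ?ler_nat //.
rewrite lef_pV2 ?posrE ?ltr0n //.
by rewrite -[k%:R]/((k%:Z)%:~R) ler_int ceil_le_int.
Qed.
End Diameter.

Lemma near_lower_bound (R : realType) (eps : R) : 0 < eps ->
  \forall p \near \oo, prime p -> exists S : {set 'F_p},
    [/\ S != finset.set0, coord_subspace R S <> 0%VS &
     (1 - eps) * ln (p%:R : R) <= relative_diam (heisenberg R p) (coord_subspace R S)].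
Proof.
move=> eps0; pose e := Num.min eps (1 / 2).
have e0 : 0 < e by rewrite lt_min eps0; lra.
have e1 : e <= 1 / 2 by rewrite ge_min lexx orbT.
have ee : e <= eps by rewrite ge_min lexx.
have [n near_n] := near_union_bound e0 e1.
apply: filterS near_n => p [m [m0 mE bound]] pr_p.
have := @thick_set_hard_to_cover 'F_p R n m m0.
rewrite card_Fp // => /(_ bound)[S [pS hard]].
have [U0 le] := relative_diam_coord_ge R pr_p pS hard.
exists S; split=> //.
  apply/eqP => S0; move: pS; rewrite S0 cards0 muln0 leqn0 => /eqP p0.
  by move: pr_p; rewrite p0.
apply: le_trans le; apply: le_trans (ltW mE).
by rewrite ler_wpM2r ?ln_p_ge0 // lerD2l lerN2.
Qed.

Lemma near_covering_complexity_ge (R : realType) (eps : R) : 0 < eps ->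
  \forall p \near \oo, prime p ->
    (1 - eps) * ln (p%:R : R) <= covering_complexity (heisenberg R p).
Proof.
move=> eps0; apply: filterS (near_lower_bound eps0) => p lower pr_p.
have [S [_ U0 le]] := lower pr_p.
exact: le_trans le ((covering_complexity_max R pr_p).2 _ U0).
Qed.

Theorem theorem6p2 (R : realType) :
  (forall eps : R, 0 < eps ->
     \forall p \near \oo, prime p ->
       exists S : {set 'F_p}, S != finset.set0 /\
         (1 - eps) * ln (p%:R : R) <=
           relative_diam (heisenberg R p) (coord_subspace R S)) /\
  (exists o : nat -> R,
     o n @[n --> within [set p | prime p] \oo] --> (0 : R) /\
     \forall p \near \oo, prime p ->
       covering_complexity (heisenberg R p) =
         (1 + o p) * ln ((\dim {:group_algebra R p})%:R : R)).
Proof.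
split=> [eps eps0|].
  apply: filterS (near_lower_bound eps0) => p lower pr_p.
  by have [S [S0 _ le]] := lower pr_p; exists S.
pose ln_dim p : R := ln (\dim {:group_algebra R p})%:R.
exists (fun p => covering_complexity (heisenberg R p) / ln_dim p - 1); split.
  apply/cvgrPdist_le => eps eps0; rewrite near_withinE.
  near=> p => pr_p; rewrite sub0r normrN /ln_dim dim_prime_group_algebra //.
  have L1 : 1 <= ln p%:R :> R by near: p; exact: near_ln_ge.
  have Leps : eps^-1 <= ln p%:R :> R by near: p; exact: near_ln_ge.
  have lower : (1 - eps) * ln (p%:R : R) <= covering_complexity (heisenberg R p).
    by move: (pr_p : prime p); near: p; exact: near_covering_complexity_ge.
  have upper := covering_complexity_le R pr_p.
  have L0 : 0 < ln p%:R :> R by lra.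
  rewrite ler_norml lerBrDr lerBlDr ler_pdivrMr // ler_pdivlMr //.
  rewrite addrC lower /= (le_trans upper) // mulrDl mul1r addrC lerD2r.
  by rewrite mulrC -ler_pdivrMr // div1r.
near=> p => pr_p; rewrite -/(ln_dim p) addrC subrK divfK //.
rewrite /ln_dim dim_prime_group_algebra // gt_eqF //.
by apply: (@lt_le_trans _ _ 1) => //; near: p; exact: near_ln_ge.
Unshelve. all: by end_near. Qed.
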